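(* For $k\in\mathbb{N}$, define $g_k(x,\theta)=e^{-\lambda_k x}\sin(\theta+x\rho_k)$, where $\inf_{k\in\mathbb{N}}\lambda_k>0$ and $\rho_k,\theta\in\mathbb{R}$. Then for any sequence $\{c_k\}_{k\in\mathbb{N}}\in l^1$, the weighted time average $$\frac{1}{A_N}\sum_{n=0}^{N-1}w(n/N)\,g(n,\theta)$$ of the superimposed wave $g(x,\theta)=\sum_{k\in\mathbb{N}}c_kg_k(x,\theta)$ converges uniformly (with respect to $\theta$) and exponentially to $0$ as $N\to+\infty$.
   Context: Let $w:\mathbb{R}\to\mathbb{R}$ be the weighting function $w(x)=\left(\int_0^1\exp(-s^{-1}(1-s)^{-1})\,ds\right)^{-1}\exp(-x^{-1}(1-x)^{-1})$ for $x\in(0,1)$ and $w(x)=0$ for $x\notin(0,1)$. Let $A_N=\sum_{n=0}^{N-1}w(n/N)$ (positive for $N\geq2$). Exponential convergence to $0$ of a sequence indexed by $N$ means that it is $\mathcal{O}(\exp(-cN^{\vartheta}))$ as $N\to+\infty$ for some constants $c,\vartheta>0$ (uniformly in $\theta$: with constants and implied constant independent of $\theta$). *)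

(* Defs.v *)
From HB Require Import structures.
From mathcomp Require Import all_boot all_order all_algebra.
From mathcomp Require Import all_classical all_reals all_analysis.
Set Implicit Arguments.
Unset Strict Implicit.
Unset Printing Implicit Defensive.
Import Order.TTheory GRing.Theory Num.Theory.
Import numFieldNormedType.Exports.
Local Open Scope classical_set_scope.
Local Open Scope ring_scope.

(* The integral is over the open interval because x^-1 takes the value 0 at
   x = 0; this does not change its value. *)
Definition weight_mass (R : realType) : R :=
  \int[@lebesgue_measure R]_(s in `]0, 1[) expR (- (s^-1 * (1 - s)^-1)).

Definition weight (R : realType) (x : R) : R :=
  if (0 < x) && (x < 1)
  then (weight_mass R)^-1 * expR (- (x^-1 * (1 - x)^-1)) else 0.

Definition weight_sum (R : realType) (N : nat) : R :=
  \sum_(0 <= n < N) weight (n%:R / N%:R).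

Definition weighted_average (R : realType) (f : nat -> R) (N : nat) : R :=
  (weight_sum R N)^-1 * \sum_(0 <= n < N) weight (n%:R / N%:R) * f n.

Definition wave (R : realType) (lambda rho : nat -> R) (k : nat) (x theta : R)
  : R := expR (- (lambda k * x)) * sin (theta + x * rho k).

(* [limn] is only meaningful when the series converges: for c in l^1 and
   0 < inf (range lambda) this is the case at every x >= 0. *)
Definition superimposed_wave (R : realType) (lambda rho c : nat -> R)
    (x theta : R) : R :=
  limn (series (fun k => c k * wave lambda rho k x theta)).

Definition in_l1 (R : realType) (c : nat -> R) : Prop :=
  cvgn [normed (series c)].

Definition uniformly_exponentially_to0 (R : realType) (T : Type)
    (u : nat -> T -> R) : Prop :=
  exists C a vartheta : R, [/\ 0 < a, 0 < vartheta &
    \forall N \near \oo, forall t : T,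
      `|u N t| <= C * expR (- (a * N%:R `^ vartheta))].

(* Main.v *)
Require Import Defs.
From HB Require Import structures.
From mathcomp Require Import all_boot all_order all_algebra.
From mathcomp Require Import all_classical all_reals all_analysis.
From mathcomp Require Import zify ring lra.
Set Implicit Arguments.
Unset Strict Implicit.
Unset Printing Implicit Defensive.
Import Order.TTheory GRing.Theory Num.Theory.
Import numFieldNormedType.Exports.
Local Open Scope classical_set_scope.
Local Open Scope ring_scope.

(** All waves decay at least like [exp (- a n)] with [a = inf lambda > 0], so
    the series at time [n] is at most [|c|_1 exp (- a n)], uniformly in
    [theta]. The weight in turn suppresses small times: up to normalisation
    [w x <= exp (- x^-1)]. With [x = n / N] the exponents combine by AM-GM,
    [x^-1 + a N x >= 2 sqrt (a N)], so every summand is at most of order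
    [exp (- 2 sqrt (a N))]. The sum of the weights is bounded below by its
    middle term, and the remaining factor [N] costs one [exp (sqrt (a N))]. *)

Definition bump (R : realType) (x : R) : R :=
  if (0 < x) && (x < 1) then expR (- (x^-1 * (1 - x)^-1)) else 0.

Lemma weightE (R : realType) (x : R) :
  weight x = (weight_mass R)^-1 * bump x.
Proof. by rewrite /weight /bump; case: ifP => // _; rewrite mulr0. Qed.

Lemma bump_ge0 (R : realType) (x : R) : 0 <= bump x.
Proof. by rewrite /bump; case: ifP => // _; exact: expR_ge0. Qed.

(* The normalising constant cancels; were it the junk value [0], the average
   would vanish. *)
Lemma weighted_average_le_bump (R : realType) (f : nat -> R) (N : nat) :
  `|weighted_average f N| <=
  (\sum_(0 <= n < N) bump (n%:R / N%:R))^-1 *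
  \sum_(0 <= n < N) bump (n%:R / N%:R) * `|f n|.
Proof.
rewrite /weighted_average /weight_sum.
under eq_bigr do rewrite weightE.
under [X in _ * X]eq_bigr do rewrite weightE -mulrA.
rewrite -!mulr_sumr.
set u := (weight_mass R)^-1; set S := \sum_(0 <= _ < _) bump _.
have S0 : 0 <= S by apply: sumr_ge0 => n _; exact: bump_ge0.
set T := \sum_(0 <= n < N) (_ * f n).
set T' := \sum_(0 <= n < N) (_ * `|f n|).
have TT' : `|T| <= T'.
  apply: (le_trans (ler_norm_sum _ _ _)); apply: ler_sum => n _.
  by rewrite normrM ger0_norm ?bump_ge0.
(* This form holds even for [u = 0], where [u^-1] is [0]; the factor [u^-1 * u] is [0] or [1], which
   the case split below settles. *)
have -> : (u * S)^-1 * (u * T) = (u^-1 * u) * (S^-1 * T).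
  by rewrite invfM; ring.
rewrite !normrM (@ger0_norm _ S^-1) ?invr_ge0//.
have [->|u0] := eqVneq u 0.
  rewrite normr0 mulr0 mul0r mulr_ge0 ?invr_ge0//.
  exact: le_trans TT'.
by rewrite -normrM mulVf// normr1 mul1r ler_wpM2l ?invr_ge0.
Qed.

Lemma bump_mul_expR_le (R : realType) (a x y : R) : 0 <= a -> 0 <= y ->
  bump x * expR (- (a * (y * x))) <= expR (- (2 * Num.sqrt (a * y))).
Proof.
move=> a0 y0; rewrite /bump; case: ifP => [/andP[x0 x1]|_]; last first.
  by rewrite mul0r expR_ge0.
rewrite -expRD ler_expR.
set s := Num.sqrt _.
have s2 : s ^+ 2 = a * y by rewrite sqr_sqrtr// mulr_ge0.
have xV : x^-1 <= x^-1 * (1 - x)^-1.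
  rewrite ler_peMr ?invr_ge0 ?(ltW x0)//.
  rewrite invf_ge1; lra.
(* AM-GM as a square: expanding gives [2 * s <= x^-1 + s ^+ 2 * x]. *)
have : 0 <= x^-1 * (1 - s * x) ^+ 2.
  by rewrite mulr_ge0 ?sqr_ge0 ?invr_ge0 ?(ltW x0).
have -> : x^-1 * (1 - s * x) ^+ 2 = x^-1 - 2 * s + s ^+ 2 * x.
  by field; rewrite gt_eqF.
rewrite s2; lra.
Qed.

(** The term of index [N./2] suffices: its argument lies between 1/3 (reached at [N = 3]) and 1/2,
    so both inverses in the exponent are at most 3. *)
Lemma bump_sum_ge (R : realType) (N : nat) : (2 <= N)%N ->
  expR (- 9 : R) <= \sum_(0 <= n < N) bump (n%:R / N%:R).
Proof.
move=> N2; have mN : (N./2 < N)%N by lia.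
rewrite big_mkord (bigD1 (Ordinal mN))//=.
rewrite -[leLHS]addr0 lerD//; last by apply: sumr_ge0 => n _; exact: bump_ge0.
have N0 : 0 < N%:R :> R by rewrite ltr0n; lia.
set x := _ / _.
have x3 : 3^-1 <= x.
  rewrite ler_pdivlMr// mulrC ler_pdivrMr// -natrM ler_nat; lia.
have x2 : x <= 2^-1.
  rewrite ler_pdivrMr// mulrC ler_pdivlMr// -natrM ler_nat; lia.
have x0 : 0 < x by lra.
rewrite /bump x0 (_ : x < 1); last by lra.
rewrite ler_expR lerN2 (_ : 9 = 3 * 3); last by ring.
apply: ler_pM; rewrite ?invr_ge0; try lra.
  by rewrite -[leRHS]invrK lef_pV2 ?posrE//; lra.
by rewrite -[leRHS]invrK lef_pV2 ?posrE//; lra.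
Qed.

Lemma weighted_average_le (R : realType) (f : nat -> R) (a K : R) (N : nat) :
  0 < a -> 0 <= K -> (forall n, `|f n| <= K * expR (- (a * n%:R))) ->
  (2 <= N)%N ->
  `|weighted_average f N| <=
  4 * K * expR 9 / a * expR (- (Num.sqrt a * N%:R `^ 2^-1)).
Proof.
move=> a0 K0 fK N2; have N0 : 0 < N%:R :> R by rewrite ltr0n; lia.
apply: le_trans (weighted_average_le_bump _ _) _.
have S9 := @bump_sum_ge R N N2.
rewrite powR12_sqrt ?(ltW N0)// -sqrtrM ?(ltW a0)//.
set s := Num.sqrt _.
have s0 : 0 <= s by exact: sqrtr_ge0.
have s2 : s ^+ 2 = a * N%:R by rewrite sqr_sqrtr// mulr_ge0 ?ltW.
apply: (@le_trans _ _ (expR 9 * (N%:R * (K * expR (- (2 * s)))))).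
  apply: ler_pM; rewrite ?invr_ge0.
  - by apply: sumr_ge0 => n _; exact: bump_ge0.
  - by apply: sumr_ge0 => n _; rewrite mulr_ge0 ?bump_ge0.
  - rewrite -[expR 9]invrK -expRN lef_pV2 ?posrE ?expR_gt0//.
    exact: lt_le_trans (expR_gt0 _) S9.
  - rewrite (_ : N%:R * _ = \sum_(0 <= n < N) K * expR (- (2 * s))); last first.
      by rewrite sumr_const_nat subn0 mulr_natl.
    apply: ler_sum => n _.
    apply: (@le_trans _ _ (bump (n%:R / N%:R) * (K * expR (- (a * n%:R))))).
      by rewrite ler_wpM2l ?bump_ge0.
    rewrite mulrCA ler_wpM2l//.
    have := @bump_mul_expR_le R a (n%:R / N%:R) N%:R (ltW a0) (ltW N0).
    by rewrite [N%:R * _]mulrC divfK ?gt_eqF.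
(* Squaring [s / 2 <= expR (s / 2)] gives [a * N = s ^+ 2 <= 4 * expR s]; this uses up one of the
   two factors [expR (- s)]. *)
have NE : N%:R <= 4 / a * expR s.
  rewrite mulrAC ler_pdivlMr// mulrC -s2.
  have : s / 2 <= expR (s / 2) by have := expR_ge1Dx (s / 2); lra.
  have -> : expR s = expR (s / 2) ^+ 2 by rewrite -expRM_natl; congr expR; lra.
  nra.
rewrite (_ : 4 * K * _ / a * _ =
    expR 9 * (4 / a * expR s * (K * expR (- (2 * s))))); last first.
  rewrite (_ : - s = s + - (2 * s)) ?expRD; last by ring.
  by field; rewrite gt_eqF.
by rewrite ler_wpM2l ?expR_ge0// ler_wpM2r ?mulr_ge0 ?expR_ge0.
Qed.

Lemma norm_wave_le (R : realType) (lambda rho : nat -> R) (a x theta : R) k :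
  a <= lambda k -> 0 <= x ->
  `|wave lambda rho k x theta| <= expR (- (a * x)).
Proof.
move=> ak x0; rewrite /wave normrM ger0_norm ?expR_ge0//.
apply: le_trans (_ : expR (- (lambda k * x)) <= _).
  by rewrite ler_piMr ?expR_ge0 ?sin_max.
by rewrite ler_expR lerN2 ler_wpM2r.
Qed.

(** The common factor [expR (- (a * x))] depends on neither [k] nor [theta], so comparison with the
    series of [c] gives both the convergence of the wave series and a bound uniform in [theta]. *)
Lemma norm_superimposed_wave_le (R : realType) (lambda rho c : nat -> R)
    (a x theta : R) :
  in_l1 c -> (forall k, a <= lambda k) -> 0 <= x ->
  `|superimposed_wave lambda rho c x theta| <=
  limn [normed series c] * expR (- (a * x)).
Proof.
move=> hc ha x0; rewrite /superimposed_wave.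
set e := expR _.
have le_term k : `|c k * wave lambda rho k x theta| <= (e *: (fun k => `|c k|)) k.
  rewrite normrM mulrC; apply: ler_wpM2r => //; exact: norm_wave_le.
have cvge := @is_cvg_seriesZ _ _ e hc.
have cvgn : cvgn [normed series (fun k => c k * wave lambda rho k x theta)].
  apply: series_le_cvg le_term cvge => // k.
  by rewrite mulr_ge0 ?expR_ge0.
apply: le_trans (lim_series_norm cvgn) _.
apply: le_trans (lim_series_le cvgn cvge le_term) _.
by rewrite lim_seriesZ// mulrC.
Qed.

(** [inf] takes the default value [0] on sets without an infimum, so a positive value cannot be the
    default. *)
Lemma has_lbound_inf_gt0 (R : realType) (A : set R) :
  0 < inf A -> has_lbound A.
Proof.
move=> A0; apply: contrapT => hA.
by move: A0; rewrite inf_out ?ltxx// => -[].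
Qed.

Lemma uniformly_exponentially_to0_cvg (R : realType) (T : choiceType)
    (u : nat -> T -> R) :
  uniformly_exponentially_to0 u -> {uniform, u @ \oo --> (fun=> 0)}.
Proof.
move=> [C [a [v [a0 v0 uC]]]] P /uniform_nbhs[E [entE EP]].
have [e /= e0 eE] : exists2 e : R, 0 < e & [set xy | ball xy.1 e xy.2] `<=` E.
  by move: entE; rewrite -entourage_ballE.
set M := `|C| / (e * a).
have M0 : 0 <= M by rewrite divr_ge0// mulr_ge0// ltW.
suff H : \forall N \near \oo, forall t, `|u N t| < e.
  apply: filterS H => N uN; apply: EP => t _; apply: eE.
  by rewrite /ball /= sub0r normrN.
have MN : \forall N \near \oo, M <= N%:R `^ v.
  apply: filterS (nbhs_infty_ger (M `^ v^-1)) => N /(ge0_ler_powR (ltW v0)).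
  rewrite !nnegrE powR_ge0 ler0n => /(_ isT isT).
  by rewrite -powRrM mulVf ?gt_eqF// powRr1.
apply: filterS2 uC MN => N uN MN t; apply: le_lt_trans (uN t) _.
rewrite expRN ltr_pdivrMr ?expR_gt0//; apply: le_lt_trans (ler_norm _) _.
rewrite mulrC -ltr_pdivrMr//.
apply: lt_le_trans (expR_ge1Dx _); rewrite ltr_pwDl//.
rewrite (_ : `|C| / e = a * M) ?ler_pM2l//.
by rewrite /M; field; rewrite !gt_eqF.
Qed.

Theorem corollary1p1 (R : realType) (lambda rho : nat -> R)
    (hlambda : 0 < inf (range lambda)) (c : nat -> R) (hc : in_l1 c) :
  let average (N : nat) (theta : R) : R :=
    weighted_average
      (fun n => superimposed_wave lambda rho c n%:R theta) N in
  {uniform, average @ \oo --> (fun=> 0)} /\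
  uniformly_exponentially_to0 average.
Proof.
move=> average.
suff H : uniformly_exponentially_to0 average.
  by split=> //; exact: uniformly_exponentially_to0_cvg.
set a := inf (range lambda).
(* These are the constants of [weighted_average_le] with [K] the l^1 norm of [c]; none involves
   [theta]. *)
exists (4 * limn [normed series c] * expR 9 / a), (Num.sqrt a), 2^-1.
split; [by rewrite sqrtr_gt0|by rewrite invr_gt0|].
have K0 : 0 <= limn [normed series c].
  by apply: limr_ge => //; apply: nearW => n; apply: sumr_ge0 => k _; exact: normr_ge0.
have ha k : a <= lambda k.
  by apply: ge_inf; [exact: has_lbound_inf_gt0 | exists k].
near=> N; move=> theta.
apply: weighted_average_le => // [n|].
  by apply: norm_superimposed_wave_le.
by near: N; exact: nbhs_infty_ge.
Unshelve. all: by end_near. Qed.
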